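(* Let $n$ be a positive integer, let $\mathbf a=(a_1,\ldots,a_n)\in\mathbb Z^n$ be a vector such that $0<a_1\leq a_2\leq\cdots\leq a_n$, and let $k$ be a natural number. Then the lexicographic standard monomials for $S(\mathbf a,k)$ are all ballot monomials. More precisely, with respect to the lexicographic order, $$\mathrm{sm}(I(S(\mathbf a,k)))\subseteq \mathcal M_{\lfloor n/2\rfloor,n}.$$
   Context: Natural numbers include $0$, and $[n]=\{1,\ldots,n\}$. For $\mathbf a=(a_1,\ldots,a_n)$ with positive integer components and a natural number $k$, put $$S(\mathbf a,k)=\Big\{(v_1,\ldots,v_n)\in\{0,1\}^n:\ \sum_{i=1}^n a_iv_i=k\Big\}\subseteq\mathbb Q^n .$$ For a finite set $V\subseteq\mathbb Q^n$, $I(V)$ denotes the ideal of all polynomials $f\in\mathbb Q[x_1,\ldots,x_n]$ with $f(\mathbf v)=0$ for every $\mathbf v\in V$. The lexicographic order $\prec_l$ on monomials is defined by $x_1^{i_1}\cdots x_n^{i_n}\prec_l x_1^{j_1}\cdots x_n^{j_n}$ iff $i_m<j_m$ holds for the smallest index $m$ with $i_m\neq j_m$ (so $x_1\succ_l x_2\succ_l\cdots\succ_l x_n$). The leading monomial of a nonzero polynomial is the largest monomial, with respect to the order, occurring in it with nonzero coefficient. A monomial is a standard monomial for an ideal $I$ if it is not the leading monomial of any nonzero $f\in I$; $\mathrm{sm}(I)$ is the set of standard monomials of $I$. The lexicographic standard monomials for $V$ are the standard monomials for $I(V)$ with respect to $\prec_l$. For $G\subseteq[n]$ write $\mathbf x_G=\prod_{j\in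 G}x_j$ (with $\mathbf x_\emptyset=1$). For an integer $0\leq d\leq n/2$, $\mathcal M_{d,n}$ is the set of all monomials $\mathbf x_G$ with $G=\{s_1<s_2<\cdots<s_j\}\subseteq[n]$ such that $j\leq d$ and $s_i\geq 2i$ for every $1\leq i\leq j$. These are the ballot monomials of degree at most $d$. *)

(* Defs.v *)
From mathcomp Require Export all_boot all_order all_algebra.
From mathcomp Require Export mpoly.

Set Implicit Arguments.
Unset Strict Implicit.
Unset Printing Implicit Defensive.

Import GRing.Theory Num.Theory.
Local Open Scope ring_scope.

(* Variables are indexed from 0: the ordinal i : 'I_n stands for the index
   i.+1 of [n] = {1, ..., n}. *)

Definition knapsack (n : nat) (a : 'I_n -> int) (k : nat) (v : 'rV[rat]_n) :
    Prop :=
  (forall i, v 0 i = 0 \/ v 0 i = 1) /\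
  \sum_(i < n) (a i)%:~R * v 0 i = k%:R.

Definition vanishing_ideal (n : nat) (V : 'rV[rat]_n -> Prop)
    (f : {mpoly rat[n]}) : Prop :=
  forall v, V v -> f.@[v 0] = 0.

(* The library's own order on 'X_{1..n} is graded, hence is not this one. *)
Definition lex_lt (n : nat) (m1 m2 : 'X_{1..n}) : Prop :=
  exists i : 'I_n,
    (m1 i < m2 i)%N /\ (forall j : 'I_n, (j < i)%N -> m1 j = m2 j).

Definition leading_monomial (n : nat) (lt : 'X_{1..n} -> 'X_{1..n} -> Prop)
    (f : {mpoly rat[n]}) (m : 'X_{1..n}) : Prop :=
  m \in msupp f /\ (forall m', m' \in msupp f -> m' <> m -> lt m' m).

Definition standard_monomial (n : nat) (lt : 'X_{1..n} -> 'X_{1..n} -> Prop)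
    (I : {mpoly rat[n]} -> Prop) (m : 'X_{1..n}) : Prop :=
  ~ exists f : {mpoly rat[n]}, [/\ f != 0, I f & leading_monomial lt f m].

(* For G = {s_1 < ... < s_j}, [elements G] is [:: s_1; ...; s_j], with
   1-based values; it is increasing because [enum] lists ordinals in order. *)
Definition elements (n : nat) (G : {set 'I_n}) : seq nat :=
  [seq (val i).+1 | i <- enum G].

Lemma elements_sorted (n : nat) (G : {set 'I_n}) : sorted ltn (elements G).
Proof.
rewrite /elements sorted_map /enum_mem.
apply: sorted_filter; first by move=> y x z; apply: ltn_trans.
have := iota_ltn_sorted 0 n; rewrite -val_enum_ord sorted_map enumT; exact.
Qed.

(* [mesym1 G] is the squarefree monomial x_G; s_i is at position i.-1. *)
Definition ballot (d n : nat) (m : 'X_{1..n}) : Prop :=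
  exists G : {set 'I_n},
    [/\ m = mesym1 G,
        (size (elements G) <= d)%N
      & forall i, (1 <= i <= size (elements G))%N ->
          (2 * i <= nth 0 (elements G) i.-1)%N].

(* Main.v *)
From mathcomp Require Import zify ring.
Require Import Defs.
Local Open Scope ring_scope.

Import GRing.Theory Num.Theory Order.TTheory.
Set Implicit Arguments.
Unset Strict Implicit.
Unset Printing Implicit Defensive.

(** Let x^m be standard.  Since x_i (x_i - 1) vanishes on {0,1}-points, m is
squarefree, say x^m = x_G.  The monomial x_G is ballot exactly when every
initial segment [N] of the indices satisfies 2 |G :&: [N]| <= N.  Suppose this
fails, and take the least failing N.  Write T = G :&: [N], C = [N] :\: G.

Minimality of N makes T heavier than C: with signs e_j = 1 on G and -1 off G,
all partial sums of e before N are nonpositive while the sum up to N is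
positive, and the weights are nondecreasing, so summation by parts gives
sum_(j <= N) a_j e_j >= a_N sum_(j <= N) e_j > 0
([abel_lower_bound], [first_excess_dominates]).

Now take a point v of the knapsack set and let r be the weight that its first
N coordinates must contribute, r = k - sum_(i > N) a_i v_i.  If r exceeds the
weight of C, then v cannot vanish on all of T.  Otherwise r is less than the
weight of T, and v cannot be equal to 1 on all of T.  Which case occurs depends
only on the coordinates after N, so it is decided by a polynomial e in the
variables after N whose value is 1 in the first case and 0 in the second
([tail_indicator]).  In both cases some j in T has v_j = e(v), so that
prod_(j in T) (x_j - e) vanishes on the knapsack set.  As e involves only
variables smaller than those of T, its leading monomial is x_T
([dominant_leading]).  But x_T divides x^m, which contradicts that x^m is
standard ([lex_monic_not_standard]).

In terms of the lex game of Felszeghy, Rath and Ronyai, the player who owns the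
coordinates in G wins by setting all of T to 1, or all of T to 0. *)

(** * Leading monomials in the lexicographic order *)

Lemma lex_lt_irr (n : nat) (m : 'X_{1..n}) : ~ lex_lt m m.
Proof. by case=> i [+ _]; rewrite ltnn. Qed.

Lemma lex_lt_trans (n : nat) (m2 m1 m3 : 'X_{1..n}) :
  lex_lt m1 m2 -> lex_lt m2 m3 -> lex_lt m1 m3.
Proof.
move=> [i [lt12 eq12]] [j [lt23 eq23]].
case: (ltngtP i j) => [lt_ij|lt_ji|/val_inj eq_ij].
- exists i; split=> [|l lt_li]; first by rewrite -eq23.
  by rewrite eq12 // eq23 // (ltn_trans lt_li).
- exists j; split=> [|l lt_lj]; first by rewrite eq12.
  by rewrite eq12 ?eq23 // (ltn_trans lt_lj).
- rewrite -{}eq_ij in lt23 eq23; exists i; split=> [|l lt_li].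
    exact: ltn_trans lt23.
  by rewrite eq12 // eq23.
Qed.

Lemma lex_lt_add2r (n : nat) (w m1 m2 : 'X_{1..n}) :
  lex_lt m1 m2 -> lex_lt (m1 + w)%MM (m2 + w)%MM.
Proof.
move=> [i [lt12 eq12]]; exists i; rewrite !mnmDE ltn_add2r; split=> // j lt_ji.
by rewrite !mnmDE eq12.
Qed.

Lemma lex_lt_add2l (n : nat) (w m1 m2 : 'X_{1..n}) :
  lex_lt m1 m2 -> lex_lt (w + m1)%MM (w + m2)%MM.
Proof. by rewrite ![(w + _)%MM]addmC; exact: lex_lt_add2r. Qed.

(** The leading monomial is u, with leading coefficient 1; subtracting 'X_[u]
instead of asking for a maximum in the support makes products easy. *)
Definition lex_monic (n : nat) (u : 'X_{1..n}) (f : {mpoly rat[n]}) : Prop :=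
  forall m, m \in msupp (f - 'X_[u]) -> lex_lt m u.

Lemma lex_monic_X (n : nat) (u : 'X_{1..n}) : lex_monic u 'X_[u].
Proof. by move=> m; rewrite subrr msupp0. Qed.

Lemma lex_monicM (n : nat) (u w : 'X_{1..n}) (f g : {mpoly rat[n]}) :
  lex_monic u f -> lex_monic w g -> lex_monic (u + w)%MM (f * g).
Proof.
move=> ltf ltg m.
have -> : f * g - 'X_[u + w] =
    'X_[u] * (g - 'X_[w]) + (f - 'X_[u]) * 'X_[w]
    + (f - 'X_[u]) * (g - 'X_[w]) by rewrite mpolyXD; ring.
move=> /msuppD_le; rewrite mem_cat => /orP[/msuppD_le|].
- rewrite mem_cat => /orP[] /msuppM_le /allpairsP[[m1 m2] /= []].
  + by rewrite msuppX inE => /eqP-> /ltg lt2 ->; apply: lex_lt_add2l.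
  + by rewrite msuppX inE => /ltf lt1 /eqP-> ->; apply: lex_lt_add2r.
- move=> /msuppM_le /allpairsP[[m1 m2] /= [/ltf lt1 /ltg lt2 ->]].
  by apply: (@lex_lt_trans _ (m1 + w)%MM); [exact: lex_lt_add2l|exact: lex_lt_add2r].
Qed.

Lemma lex_monic_prod (n : nat) (I : finType) (A : {set I})
    (u : I -> 'X_{1..n}) (f : I -> {mpoly rat[n]}) :
  (forall i, i \in A -> lex_monic (u i) (f i)) ->
  lex_monic (\sum_(i in A) u i)%MM (\prod_(i in A) f i).
Proof.
move=> mon_f; apply: (big_rec2 (fun w g => lex_monic w g)).
  by rewrite -mpolyX0; exact: lex_monic_X.
by move=> i g w iA; apply: lex_monicM; exact: mon_f.
Qed.

Lemma lex_monic_leading (n : nat) (u : 'X_{1..n}) (f : {mpoly rat[n]}) :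
  lex_monic u f -> leading_monomial (@lex_lt n) f u.
Proof.
move=> mon_f; split=> [|m' + neq].
  have /memN_msupp_eq0 : u \notin msupp (f - 'X_[u]).
    by apply/negP=> /mon_f; exact: lex_lt_irr.
  by rewrite mcoeffB mcoeffX eqxx mcoeff_msupp => /subr0_eq ->; rewrite oner_eq0.
move=> m'f; apply: mon_f; rewrite mcoeff_msupp mcoeffB mcoeffX.
by case: (eqVneq u m') => [/esym/neq//|_]; rewrite subr0 -mcoeff_msupp.
Qed.

(** Standard monomials are closed under division: a polynomial of the ideal with
leading monomial u can be multiplied by 'X_[m - u]. *)
Lemma lex_monic_not_standard (n : nat) (V : 'rV[rat]_n -> Prop)
    (u m : 'X_{1..n}) (f : {mpoly rat[n]}) :
  vanishing_ideal V f -> lex_monic u f -> (forall i, u i <= m i)%N ->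
  ~ standard_monomial (@lex_lt n) (vanishing_ideal V) m.
Proof.
move=> Vf mon_f /mnm_lepP le_um; apply.
have mon_g : lex_monic m (f * 'X_[m - u]).
  have := lex_monicM mon_f (@lex_monic_X n (m - u)%MM).
  by rewrite addmC submK.
have lead_g := lex_monic_leading mon_g.
exists (f * 'X_[m - u]); split=> // [|v Vv]; last by rewrite mevalM Vf // mul0r.
by apply: contraTneq (lead_g.1) => ->; rewrite msupp0.
Qed.

(** * Polynomials in the last variables *)

Definition in_tail (n N : nat) (p : {mpoly rat[n]}) : Prop :=
  forall m, m \in msupp p -> forall i : 'I_n, (i < N)%N -> m i = 0%N.

Lemma in_tailC (n N : nat) (c : rat) : in_tail N c%:MP_[n].
Proof.
move=> m; rewrite msuppC; case: eqP => // _.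
by rewrite inE => /eqP-> i; rewrite mnm0E.
Qed.

Lemma in_tailX (n N : nat) (j : 'I_n) : (N <= j)%N ->
  in_tail N ('X_j : {mpoly rat[n]}).
Proof.
move=> le_Nj m; rewrite msuppX inE => /eqP-> i lt_iN; rewrite mnm1E.
by case: eqP => // eq_ji; move: lt_iN; rewrite -eq_ji ltnNge le_Nj.
Qed.

Lemma in_tailD (n N : nat) (p q : {mpoly rat[n]}) :
  in_tail N p -> in_tail N q -> in_tail N (p + q).
Proof.
by move=> tp tq m /msuppD_le; rewrite mem_cat => /orP[/tp|/tq].
Qed.

Lemma in_tailN (n N : nat) (p : {mpoly rat[n]}) : in_tail N p -> in_tail N (- p).
Proof. by move=> tp m; rewrite (perm_mem (msuppN p)); exact: tp. Qed.

Lemma in_tailM (n N : nat) (p q : {mpoly rat[n]}) :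
  in_tail N p -> in_tail N q -> in_tail N (p * q).
Proof.
move=> tp tq m /msuppM_le /allpairsP[[m1 m2] /= [/tp t1 /tq t2 ->]] i lt_iN.
by rewrite mnmDE t1 // t2.
Qed.

(** The lexicographic order compares x_j with any monomial in strictly later
variables, whatever its degree, in favour of x_j. *)
Lemma lex_monic_XB_tail (n N : nat) (j : 'I_n) (p : {mpoly rat[n]}) :
  (j < N)%N -> in_tail N p -> lex_monic U_(j)%MM ('X_j - p).
Proof.
move=> lt_jN /in_tailN tp m; rewrite addrAC subrr add0r => /tp m0.
exists j; rewrite m0 // mnm1E eqxx; split=> // l lt_lj.
rewrite m0 ?(ltn_trans lt_lj) // mnm1E.
by case: eqP => // eq_jl; move: lt_lj; rewrite eq_jl ltnn.
Qed.

(** Any property of the later coordinates of a {0,1}-point is decided by a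
polynomial in the later variables: sum the interpolation polynomials of the
points of the tail cube that have the property. *)
Lemma tail_indicator (n N : nat) (P : pred {set 'I_n}) :
  exists2 e : {mpoly rat[n]}, in_tail N e &
    forall B : {set 'I_n}, e.@[fun i => (i \in B)%:R] =
      (P [set i in B | (N <= i)%N])%:R.
Proof.
pose tail := [set i : 'I_n | (N <= i)%N].
pose delta (A : {set 'I_n}) : {mpoly rat[n]} :=
  \prod_(i in tail) (if i \in A then 'X_i else 1%:MP - 'X_i).
exists (\sum_(A : {set 'I_n} | (A \subset tail) && P A) delta A) => [|B].
  apply: big_ind => [||A _]; [exact: in_tailC|exact: in_tailD|].
  apply: big_ind => [||i]; [exact: in_tailC|exact: in_tailM|].
  rewrite inE => le_Ni; case: ifP => _; first exact: in_tailX.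
  by apply: in_tailD; [exact: in_tailC|apply: in_tailN; exact: in_tailX].
have -> : [set i in B | (N <= i)%N] = B :&: tail by apply/setP=> i; rewrite !inE.
have delta_eval (A : {set 'I_n}) : A \subset tail ->
    (delta A).@[fun i => (i \in B)%:R] = (A == B :&: tail)%:R.
  move=> sAt; rewrite rmorph_prod /=.
  have -> : (A == B :&: tail) = [forall i in tail, (i \in A) == (i \in B)].
    apply/eqP/forall_inP => [-> i it|eqAB].
      by rewrite inE it andbT.
    apply/setP=> i; rewrite inE; have [it|it] := boolP (i \in tail).
      by rewrite andbT (eqP (eqAB i it)).
    by rewrite andbF; apply: contraNF it; exact: (subsetP sAt).
  case: forall_inP => [eqAB|/forall_inP].
    apply: big1 => i it; rewrite (eqP (eqAB i it)).
    by case: ifP => iB; rewrite ?mevalB ?mevalC mevalXU iB ?subr0.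
  rewrite negb_forall => /existsP[i]; rewrite negb_imply => /andP[it neq].
  rewrite (bigD1 i it) /=.
  case: ifP neq => iA; rewrite ?mevalB ?mevalC mevalXU;
  by case: (i \in B) => // _; rewrite ?subrr mul0r.
rewrite raddf_sum /= (eq_bigr (fun A => (A == B :&: tail)%:R)); last first.
  by move=> A /andP[/delta_eval].
have [PB|nPB] := boolP (P _).
  rewrite (bigD1 (B :&: tail)) ?subsetIr //= eqxx big1 ?addr0 // => A /andP[_].
  by move/negbTE->.
apply: big1 => A /andP[_ PA].
by case: eqP => // eqA; rewrite -eqA PA in nPB.
Qed.

(** * Polynomials that vanish on a knapsack set *)

Lemma mesym1_sum (n : nat) (A : {set 'I_n}) :
  mesym1 A = (\sum_(j in A) U_(j))%MM.
Proof.
apply/mnmP=> i; rewrite mnmE mnm_sumE.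
under eq_bigr do rewrite mnm1E.
have [iA|iA] := boolP (i \in A).
  rewrite (bigD1 i) //= eqxx big1 // => j /andP[_ /negbTE ->] //.
by rewrite big1 // => j jA; case: eqP => // eq_ji; rewrite -eq_ji jA in iA.
Qed.

Lemma zero_one_support (n : nat) (v : 'rV[rat]_n) :
  (forall i, v 0 i = 0 \/ v 0 i = 1) ->
  forall i, v 0 i = (i \in [set j | v 0 j == 1])%:R.
Proof. by move=> v01 i; rewrite inE; case: (v01 i) => ->. Qed.

Lemma weight_subset (n : nat) (a : 'I_n -> int) (A B : {set 'I_n}) :
  (forall i, 0 < a i) -> A \subset B ->
  \sum_(i in A) a i <= \sum_(i in B) a i.
Proof.
move=> a_gt0 sAB; rewrite [leRHS](big_setID A) /= (setIidPr sAB) lerDl.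
by apply: sumr_ge0 => i _; exact: ltW.
Qed.

Lemma knapsack_weight (n : nat) (a : 'I_n -> int) (k : nat) (v : 'rV[rat]_n) :
  knapsack a k v ->
  \sum_(i in [set j | v 0 j == 1]) a i = k%:Z.
Proof.
move=> [v01 sum_v]; apply: (@intr_inj rat).
rewrite rmorph_sum -[RHS]sum_v [RHS](bigID (mem [set j | v 0 j == 1])) /=.
rewrite [X in _ = _ + X]big1 ?addr0 => [|i /negbTE ni]; last first.
  by rewrite zero_one_support // ni mulr0.
by apply: eq_bigr => i iB; rewrite zero_one_support // iB mulr1.
Qed.

(** If the weight of the initial segment splits unevenly between T and C, then
the weight left for the segment either exceeds that of C, so that some
coordinate in T is 1, or falls short of that of T, so that some coordinate in T
is 0.  A polynomial e in the later variables tells which of these values is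
forced, so some factor of prod_(j in T) ('X_j - e) vanishes. *)
Lemma dominant_leading (n : nat) (a : 'I_n -> int) (k N : nat)
    (T C : {set 'I_n}) :
  (forall i, 0 < a i) ->
  (forall i : 'I_n, (i < N)%N = (i \in T :|: C)) ->
  \sum_(i in C) a i < \sum_(i in T) a i ->
  exists2 f, vanishing_ideal (knapsack a k) f & lex_monic (mesym1 T) f.
Proof.
move=> a_gt0 TC ltCT.
(* A is the part of the support of the point after the initial segment. *)
pose P (A : {set 'I_n}) := \sum_(i in C) a i < k%:Z - \sum_(i in A) a i.
have [e tail_e eval_e] := tail_indicator N P.
exists (\prod_(j in T) ('X_j - e)); last first.
  rewrite mesym1_sum; apply: lex_monic_prod => j jT.
  by apply: lex_monic_XB_tail tail_e; rewrite TC inE jT.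
move=> v Vv; have [v01 _] := Vv; have := knapsack_weight Vv.
have supp_v := zero_one_support v01.
set B := [set j | _] in supp_v * => wB.
have -> : forall f : {mpoly rat[n]}, f.@[v 0] = f.@[fun i => (i \in B)%:R].
  by move=> f; apply: meval_eq.
set A := [set i in B | (N <= i)%N] in eval_e.
have sAB : A \subset B by apply/subsetP=> i; rewrite inE => /andP[].
have wBA : \sum_(i in B :\: A) a i = k%:Z - \sum_(i in A) a i.
  by rewrite -wB [X in X - _](big_setID A) /= (setIidPr sAB) addrAC subrr add0r.
have inBA i : (i \in B :\: A) = (i \in B) && (i \in T :|: C).
  by rewrite -TC in_setD [i \in A]inE ltnNge; case: (i \in B); rewrite ?andbT ?andbF.
(* Some factor 'X_j - e is zero at v, as P A is the value of e there. *)
suff [j jT jB] : exists2 j, j \in T & (j \in B) = P A.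
  rewrite rmorph_prod (bigD1 j) //= mevalB mevalXU eval_e.
  by rewrite -/A jB subrr mul0r.
have [PA|nPA] := boolP (P A).
- have : ~~ (B :\: A \subset C).
    by apply: contraL PA => /(weight_subset a_gt0); rewrite /P -wBA -leNgt.
  case/subsetPn=> j; rewrite inBA in_setU => /andP[jB /orP[jT|->//]] _.
  by exists j.
- have : ~~ (T \subset B :\: A).
    apply: contra nPA => /(weight_subset a_gt0); rewrite /P -wBA.
    exact: lt_le_trans.
  case/subsetPn=> j jT; rewrite inBA in_setU jT andbT => /negbTE jB.
  by exists j.
Qed.

(** * Ballot sets and their initial segments *)

(** Summation by parts, done by induction: as the partial sum of e before M is
nonpositive, replacing its factor b (M - 1) by the larger b M lowers the
bound. *)
Lemma abel_lower_bound (b e : nat -> int) (M : nat) :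
  (forall j, (j < M)%N -> b j <= b j.+1) ->
  (forall l, (l <= M)%N -> \sum_(0 <= j < l) e j <= 0) ->
  b M * \sum_(0 <= j < M.+1) e j <= \sum_(0 <= j < M.+1) b j * e j.
Proof.
elim: M => [|M IHM] b_mono e_le0; first by rewrite !big_nat1.
rewrite [leRHS]big_nat_recr // [X in _ * X]big_nat_recr //= mulrDr lerD2r.
apply: le_trans (IHM _ _) => [||l le_lM].
- by apply: ler_wnM2r; [exact: e_le0|exact: b_mono].
- by move=> j lt_jM; apply: b_mono; exact: ltnW.
- by apply: e_le0; exact: ltnW.
Qed.

Definition prefix_count (n : nat) (G : {set 'I_n}) (N : nat) : nat :=
  #|[set i in G | (i < N)%N]|.

(** The i-th element s of G is at least 2 i because the initial segment [s]
already contains i elements of G. *)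
Lemma ballot_of_prefix_count (n : nat) (G : {set 'I_n}) :
  (forall N, (N <= n)%N -> (2 * prefix_count G N <= N)%N) ->
  ballot (n %/ 2) (mesym1 G).
Proof.
move=> half; have size_el : size (elements G) = #|G| by rewrite size_map -cardE.
(* The entries of [elements] are 1-based, hence <= s here against < s in
   [prefix_count]. *)
have countE s : count (leq^~ s) (elements G) = prefix_count G s.
  rewrite count_map /prefix_count cardE -size_filter -filter_predI.
  congr size; apply: eq_filter => i /=.
  by rewrite inE andbC.
exists G; split=> // [|i /andP[i_gt0 le_iG]].
  have -> : size (elements G) = prefix_count G n.
    rewrite size_el; apply: eq_card => i; rewrite inE ltn_ord andbT //.
  by rewrite leq_divRL // mulnC; exact: half.
set s := nth _ _ _.
have el_i : (i.-1 < size (elements G))%N by rewrite prednK.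
have le_sn : (s <= n)%N.
  have /mapP[j _ ->] : s \in elements G by apply: mem_nth.
  exact: ltn_ord.
apply: leq_trans (half s le_sn); rewrite leq_mul2l -countE /=.
rewrite -(cat_take_drop i (elements G)) count_cat.
apply: leq_trans (leq_addr _ _).
have -> : count (leq^~ s) (take i (elements G)) = size (take i (elements G)).
  apply/eqP; rewrite -all_count; apply/(all_nthP 0) => j.
  rewrite size_takel // => lt_ji; rewrite nth_take // /s.
  have := elements_sorted G.
  rewrite ltn_sorted_uniq_leq => /andP[_ srt].
  apply: (sorted_leq_nth leq_trans leqnn 0 srt); rewrite ?inE //; lia.
by rewrite size_takel.
Qed.

Lemma prefix_sum (n N : nat) (F : 'I_n.+1 -> int) : (N <= n.+1)%N ->
  \sum_(0 <= j < N) F (inord j) = \sum_(i : 'I_n.+1 | (i < N)%N) F i.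
Proof.
move=> le_Nn; rewrite big_mkord (big_ord_widen n.+1 (F \o @inord n) le_Nn).
by apply: eq_bigr => i _ /=; rewrite inord_val.
Qed.

Lemma prefix_count_excess (n N : nat) (G : {set 'I_n.+1}) : (N <= n.+1)%N ->
  \sum_(0 <= j < N) (if inord j \in G then 1 else -1 : int) =
    (2 * prefix_count G N)%:Z - N%:Z.
Proof.
move=> le_Nn; rewrite (prefix_sum (fun i => if i \in G then 1 else -1)) //.
have card_prefix : \sum_(i : 'I_n.+1 | (i < N)%N) (1 : int) = N%:Z.
  by rewrite -(prefix_sum (fun=> 1)) // sumr_const_nat subn0 natz.
have card_G : \sum_(i : 'I_n.+1 | (i < N)%N && (i \in G)) (1 : int) =
    (prefix_count G N)%:Z.
  rewrite /prefix_count -sum1_card -[RHS]natz natr_sum.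
  by apply: eq_bigl => i; rewrite inE andbC.
rewrite -{}card_prefix PoszM -{}card_G.
rewrite (bigID (mem G)) [in RHS](bigID (mem G) (fun i : 'I_n.+1 => (i < N)%N)) /=.
rewrite (eq_bigr (fun=> 1)) => [|i /andP[_ ->]//].
rewrite [X in _ + X](eq_bigr (fun=> -1)) => [|i /andP[_ /negbTE ->]//].
rewrite sumrN; ring.
Qed.

(** This is where the monotonicity of the weights enters: before the first excess
the elements outside G are at least as numerous as those in G on every initial
segment, so each of them can be matched to a later, hence heavier, element of G,
and one element of G is left over. *)
Lemma first_excess_dominates (n N : nat) (a : 'I_n.+1 -> int) (G : {set 'I_n.+1}) :
  (forall i, 0 < a i) -> (forall i j : 'I_n.+1, (i <= j)%N -> a i <= a j) ->
  (N <= n.+1)%N -> (N < 2 * prefix_count G N)%N ->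
  (forall M, (M < N)%N -> (2 * prefix_count G M <= M)%N) ->
  \sum_(i in [set i : 'I_n.+1 | (i < N)%N && (i \notin G)]) a i <
  \sum_(i in [set i : 'I_n.+1 | (i < N)%N && (i \in G)]) a i.
Proof.
move=> a_gt0 a_mono; case: N => [|N] le_Nn excess minN.
  suff /eqP pc0 : prefix_count G 0 == 0%N by rewrite pc0 in excess.
  by rewrite cards_eq0; apply/eqP/setP=> i; rewrite !inE ltn0 andbF.
pose e j : int := if inord j \in G then 1 else -1.
have bound : a (inord N) * \sum_(0 <= j < N.+1) e j <=
    \sum_(0 <= j < N.+1) a (inord j) * e j.
  apply: (abel_lower_bound (b := a \o @inord n)) => [j lt_jN|l le_lN] /=.
    by apply: a_mono; rewrite !inordK //; lia.
  by rewrite prefix_count_excess; [have := minN l; lia|lia].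
have top_gt0 : 0 < a (inord N) * \sum_(0 <= j < N.+1) e j.
  by rewrite mulr_gt0 // prefix_count_excess //; lia.
have := lt_le_trans top_gt0 bound.
rewrite (prefix_sum (fun i => a i * (if i \in G then 1 else -1))) //.
rewrite (bigID (mem G)) /= (eq_bigr a) => [|i /andP[_ ->]]; last by rewrite mulr1.
rewrite [X in _ + X](eq_bigr (fun i => - a i)) => [|i /andP[_ /negbTE ->]].
  rewrite sumrN subr_gt0.
  under [X in _ -> X < _]eq_bigl do rewrite inE.
  by under [X in _ -> _ < X]eq_bigl do rewrite inE.
by rewrite mulrN1.
Qed.

Theorem theorem1p1 (n : nat) (n_gt0 : (0 < n)%N) (a : 'I_n -> int)
    (a_gt0 : forall i : 'I_n, 0 < a i)
    (a_mono : forall i j : 'I_n, (i <= j)%N -> a i <= a j)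
    (k : nat) (m : 'X_{1..n}) :
  standard_monomial (@lex_lt n) (vanishing_ideal (knapsack a k)) m ->
  ballot (n %/ 2) m.
Proof.
move=> std_m.
(* Otherwise 'X_i * ('X_i - 1), with leading monomial of degree 2 in 'X_i,
   excludes m. *)
have le_m1 i : (m i <= 1)%N.
  rewrite leqNgt; apply/negP=> m_i.
  pose f : {mpoly rat[n]} := ('X_i - 0%:MP) * ('X_i - 1%:MP).
  apply: (lex_monic_not_standard (f := f) (u := (U_(i) + U_(i))%MM) _ _ _ std_m).
  - move=> v [v01 _]; rewrite mevalM !mevalB !mevalC !mevalXU.
    by case: (v01 i) => ->; rewrite subrr ?mul0r ?mulr0.
  - by apply: lex_monicM; apply: (lex_monic_XB_tail (ltnSn i)); exact: in_tailC.
  - by move=> j; rewrite mnmDE mnm1E; case: eqP => // <-.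
pose G := [set i | m i != 0%N].
have def_m : m = mesym1 G.
  by apply/mnmP=> i; rewrite mnmE inE; case: (m i) (le_m1 i) => [|[]].
rewrite {1}def_m; apply: ballot_of_prefix_count => N0 le_N0n.
rewrite leqNgt; apply/negP=> excess0.
have ex_excess : exists N, (N <= n)%N && (N < 2 * prefix_count G N)%N.
  by exists N0; rewrite le_N0n.
case: (ex_minnP ex_excess) => N /andP[le_Nn excess] minN.
move=> {N0 le_N0n excess0 ex_excess}.
case: n n_gt0 a a_gt0 a_mono m std_m le_m1 @G def_m le_Nn excess minN => // n _.
move=> a a_gt0 a_mono m std_m _ G def_m le_Nn excess minN.
have ltCT : \sum_(i in [set i : 'I_n.+1 | (i < N)%N && (i \notin G)]) a i <
    \sum_(i in [set i : 'I_n.+1 | (i < N)%N && (i \in G)]) a i.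
  apply: first_excess_dominates => // M lt_MN; rewrite leqNgt.
  apply/negP=> M_excess; suff : (N <= M)%N by rewrite leqNgt lt_MN.
  by rewrite minN // M_excess (leq_trans (ltnW lt_MN) le_Nn).
have [|f Vf mon_f] := dominant_leading k (N := N) a_gt0 _ ltCT.
  by move=> i; rewrite !inE -andb_orr orbN andbT.
apply: lex_monic_not_standard Vf mon_f _ std_m => i.
by rewrite def_m !mnmE inE; case: (i \in G); rewrite ?andbF // leq_b1.
Qed.
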